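(* Assume that $(d_0;a_0,b_0)\in\mathbb N^3$ satisfies $$(d_0+2)(a_0+b_0)=8a_0b_0,\qquad 1\le a_0\le b_0,\qquad a_0+b_0\le d_0.$$ For any integer $s\ge1$, set $$d:=(d_0+2)s-2,\qquad a:=a_0s,\qquad b:=b_0s.$$ Then $X:=\mathcal O^{(d)}_{a,b}\subset G_{2,d}$ is an equal-weight tight $2$-fusion frame.
   Context: $\mathbb N=\{1,2,\dots\}$. $G_{2,d}$ is the set of $2$-dimensional linear subspaces of $\mathbb R^d$; $P_W$ is the orthogonal projection onto $W$; $e_1,\dots,e_d$ is the standard basis of $\mathbb R^d$. The hyperoctahedral group $B_d=\{\pm1\}^d\rtimes S_d\subset O(d)$ acts on $\mathbb R^d$ by signed coordinate permutations and on $G_{2,d}$ by $g\cdot W=gW$. For integers $1\le a\le b$ with $a+b\le d$, let $u_0=\frac1{\sqrt a}\sum_{i=1}^ae_i$, $v_0=\frac1{\sqrt b}\sum_{j=a+1}^{a+b}e_j$, $W_0=\mathrm{span}(u_0,v_0)$, and define $\mathcal O^{(d)}_{a,b}:=B_d\cdot W_0\subset G_{2,d}$ (a finite orbit). For the parameters in the claim one has $a+b\le d$, so the orbit is defined. A finite set $X\subset G_{2,d}$ is an equal-weight tight $2$-fusion frame ($\mathrm{TFF}_2$) if there is a constant $A>0$ with $\sum_{W\in X}\|P_Wx\|^4=A\|x\|^4$ for all $x\in\mathbb R^d$. *)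

(* Defs.v *)
From HB Require Import structures.
From mathcomp Require Import all_boot all_order all_fingroup all_algebra.
From mathcomp Require Import finmap reals.

Set Implicit Arguments.
Unset Strict Implicit.
Unset Printing Implicit Defensive.

Import Order.TTheory GRing.Theory Num.Theory.

Local Open Scope ring_scope.

(* R^d is 'rV[R]_d. Its Euclidean structure has to be introduced here: the
   norm that MathComp-Analysis puts on matrices is the sup norm. *)
Section Euclidean.
Variables (R : realType) (d : nat).
Implicit Types (x y : 'rV[R]_d) (W : {vspace 'rV[R]_d}).

Definition dotv x y : R := (x *m y^T) 0 0.

Lemma dotvE x y : dotv x y = \sum_i x 0 i * y 0 i.
Proof. by rewrite /dotv mxE; apply: eq_bigr => i _; rewrite mxE. Qed.

Fact dotv_linearl y : linear_for *%R (dotv^~ y).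
Proof. by move=> a u v; rewrite /dotv mulmxDl -scalemxAl !mxE. Qed.

Fact dotv_linearr x : linear_for *%R (dotv x).
Proof. by move=> a u v; rewrite /dotv linearP /= mulmxDr -scalemxAr !mxE. Qed.

HB.instance Definition _ := bilinear_isBilinear.Build R
  'rV[R]_d 'rV[R]_d R *%R *%R dotv (conj dotv_linearl dotv_linearr).

Fact dotv_sym x y : dotv x y = (-1) ^+ false * idfun (dotv y x).
Proof.
by rewrite expr0 mul1r /= !dotvE; apply: eq_bigr => i _; rewrite mulrC.
Qed.

HB.instance Definition _ := isHermitianSesquilinear.Build R 'rV[R]_d false
  idfun dotv dotv_sym.

Fact dotv_gt0 x : x != 0 -> 0 < dotv x x.
Proof.
move=> x0; rewrite dotvE lt_neqAle; apply/andP; split; last first.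
  by apply: sumr_ge0 => i _; rewrite -expr2 sqr_ge0.
apply: contraNneq x0 => /esym/eqP.
rewrite psumr_eq0 => [/allP h|i _]; last by rewrite -expr2 sqr_ge0.
apply/eqP/rowP => i; rewrite mxE.
by have := h i (mem_index_enum _); rewrite /= -expr2 sqrf_eq0 => /eqP.
Qed.

HB.instance Definition _ := isDotProduct.Build R 'rV[R]_d dotv dotv_gt0.

Definition norm2 x : R := Num.sqrt (dotv x x).

(* Projection onto W along its orthogonal complement. *)
Definition orthoproj W : 'End('rV[R]_d) :=
  daddv_pi W (orthov (dotv : {symmetric 'rV[R]_d}) W).

Lemma mem_orthoproj W x : orthoproj W x \in W.
Proof. exact: memv_pi. Qed.

Lemma orthoproj_ortho W x w : w \in W -> dotv (x - orthoproj W x) w = 0.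
Proof.
set V := orthov (dotv : {symmetric 'rV[R]_d}) W => wW.
have WV0 : (W :&: V = 0)%VS.
  apply/eqP; rewrite -subv0; apply/subvP => v.
  rewrite memv_cap => /andP[vW /mem_orthovP/(_ _ vW)/= vv].
  by rewrite memv0; apply: contra_eqT vv => /dotv_gt0; rewrite lt0r => /andP[].
pose f : 'Hom('rV[R]_d, 'rV_(\dim W)) :=
  linfun (mulmxr (\matrix_(i < d, j < \dim W) (vbasis W)`_j 0 i)).
have kerf : (lker f <= V)%VS.
  apply/subvP => v; rewrite memv_ker lfunE /= => /eqP/rowP fv.
  apply/mem_orthovP => u /coord_vbasis ->.
  rewrite linear_sumr big1 // => k _; rewrite linearZ /=.
  suff -> : dotv v (vbasis W)`_k = 0 by rewrite mulr0.
  have := fv k; rewrite !mxE => fvk; rewrite dotvE -[RHS]fvk.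
  by apply: eq_bigr => i _; rewrite mxE.
have WVf : (W + V)%VS = fullv.
  apply/eqP; rewrite eqEdim subvf /= dimv_disjoint_sum //.
  rewrite -(limg_ker_dim f fullv) capfv addnC leq_add ?dimvS //.
  by rewrite (leq_trans (dimvS (subvf _))) // dimvf /dim /= mul1n.
have {1}<- : orthoproj W x + daddv_pi V W x = x.
  by apply: daddv_pi_add; rewrite // WVf memvf.
rewrite addrAC subrr add0r.
by have /mem_orthovP/(_ _ wW) := memv_pi V W x.
Qed.

Definition Gr (k : nat) : {pred {vspace 'rV[R]_d}} := [pred W | \dim W == k].

Definition equal_weight_TFF2 (X : {fset {vspace 'rV[R]_d}}) : Prop :=
  {subset X <= Gr 2} /\
  exists2 A : R, 0 < A &
    forall x, \sum_(W <- X) norm2 (orthoproj W x) ^+ 4 = A * norm2 x ^+ 4.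

End Euclidean.

(* Underlying set of {+-1}^d ><| S_d; the group law plays no role in the
   definition of the orbit. The bit [g.1 i] encodes the sign (-1) ^+ g.1 i. *)
Definition hyperoctahedral (d : nat) : Type :=
  ({ffun 'I_d -> bool} * {perm 'I_d})%type.
HB.instance Definition _ d := Finite.on (hyperoctahedral d).

Section Orbit.
Variables (R : realType) (d : nat).

(* Acting on rows from the right, it sends e_i to (-1) ^+ g.1 i e_(g.2 i). *)
Definition signed_perm_mx (g : hyperoctahedral d) : 'M[R]_d :=
  diag_mx (\row_i (-1) ^+ g.1 i) *m perm_mx g.2.

Definition hyperoct_act (g : hyperoctahedral d) (W : {vspace 'rV[R]_d}) :
    {vspace 'rV[R]_d} :=
  (linfun (mulmxr (signed_perm_mx g)) @: W)%VS.

(* The coordinates are numbered from 0. *)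
Definition u0 (a : nat) : 'rV[R]_d :=
  (Num.sqrt a%:R)^-1 *: \sum_(i < d | (i < a)%N) delta_mx 0 i.

Definition v0 (a b : nat) : 'rV[R]_d :=
  (Num.sqrt b%:R)^-1 *: \sum_(j < d | (a <= j < a + b)%N) delta_mx 0 j.

Definition W0 (a b : nat) : {vspace 'rV[R]_d} := <<[:: u0 a; v0 a b]>>%VS.

(* Meaningful for 1 <= a <= b and a + b <= d only. *)
Definition orbit_ab (a b : nat) : {fset {vspace 'rV[R]_d}} :=
  [fset hyperoct_act g (W0 a b) | g in {: hyperoctahedral d}]%fset.

End Orbit.

(* Hence [orbit_ab] is used within its range of validity, and the natural
   number subtraction in the dimension is not truncated. *)
Lemma params_admissible (d0 a0 b0 s : nat) :
  (a0 + b0 <= d0)%N -> (1 <= s)%N ->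
  (2 <= (d0 + 2) * s)%N /\ (a0 * s + b0 * s <= (d0 + 2) * s - 2)%N.
Proof.
move=> hd hs; have h2 : (2 <= 2 * s)%N by rewrite leq_pmulr.
rewrite mulnDl; split; first exact: leq_trans h2 (leq_addl _ _).
by rewrite -addnBA // -mulnDl (leq_trans _ (leq_addr _ _)) // leq_mul2r hd orbT.
Qed.

(* Main.v *)
Require Import Defs.
From mathcomp Require Import all_boot all_order all_algebra reals.
From mathcomp Require Import all_fingroup finmap ring lra.

(** Write [P] for the matrix of the orthogonal projection onto a plane [W].
    Since [|P_W x|^2 = sum_ij P_ij x_i x_j], the sum of [|P_W x|^4] over a
    family [X] of planes is the quartic form of the tensor
    [T_ijkl = sum_(W in X) P_ij P_kl] ([sum_norm2_orthoproj]).

    When [X] is stable under signed permutations, so is [T].  A sign change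
    of a single coordinate kills every [T_ijkl] in which some index occurs an
    odd number of times, and permutations identify the surviving entries.
    Hence [T] is a combination of the three isotropic pairings
    [d_ij d_kl], [d_ik d_jl], [d_il d_jk] and of the tensor [d_ijkl] supported
    on the diagonal ([invariant_tensorE]).  The pairings contribute multiples
    of [|x|^4] and [d_ijkl] contributes [sum_i x_i^4], so [X] is tight as soon
    as the coefficient of [d_ijkl] vanishes.

    One linear relation detects this: the sum of the three contractions of
    [T] must be [d + 2] times its diagonal sum ([quartic_isotropic]).  As [P]
    is symmetric and idempotent of trace 2, each plane contributes
    [(tr P)^2 + 2 tr P^2 = 8] to the contractions, so it suffices that
    [(d + 2) sum_i P_ii^2 = 8] for every plane ([invariant_TFF2]).  The sum
    [sum_i P_ii^2] is constant on an orbit, and equals [1 / a + 1 / b] for the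
    plane spanned by [u0] and [v0].  The criterion becomes
    [(d + 2) (a + b) = 8 a b] ([orbit_ab_TFF2]), an equation between forms of
    degree 2 in [(d + 2, a, b)]: it survives the scaling of [(d0 + 2, a0, b0)]
    by [s]. *)

Set Implicit Arguments.
Unset Strict Implicit.
Unset Printing Implicit Defensive.

Import Order.TTheory GRing.Theory Num.Theory.
Local Open Scope ring_scope.

(** * Signed permutations and their action on subspaces *)

Lemma dotvC (R : realType) d (x y : 'rV[R]_d) : dotv x y = dotv y x.
Proof. by rewrite dotv_sym mul1r. Qed.

Lemma dotv_ge0 (R : realType) d (x : 'rV[R]_d) : 0 <= dotv x x.
Proof. by rewrite dotvE sumr_ge0 // => i _; rewrite -expr2 sqr_ge0. Qed.

Section SignedPermutations.
Variables (R : realType) (d : nat).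
Implicit Types (g h : hyperoctahedral d) (x y : 'rV[R]_d).

Lemma signed_perm_mxE g i j :
  signed_perm_mx R g i j = (-1) ^+ g.1 i * (g.2 i == j)%:R.
Proof. by rewrite /signed_perm_mx mul_diag_mx !mxE. Qed.

Lemma mul_signed_perm g x i :
  (x *m signed_perm_mx R g) 0 (g.2 i) = (-1) ^+ g.1 i * x 0 i.
Proof.
rewrite mxE (bigD1 i) //= signed_perm_mxE eqxx mulr1 big1 ?addr0 1?mulrC // => j ji.
by rewrite signed_perm_mxE (inj_eq perm_inj) (negbTE ji) !mulr0.
Qed.

Lemma delta_signed_perm g i :
  (delta_mx 0 i : 'rV_d) *m signed_perm_mx R g = (-1) ^+ g.1 i *: delta_mx 0 (g.2 i).
Proof.
by apply/rowP => j; rewrite -rowE [LHS]mxE signed_perm_mxE !mxE eqxx /= [j == _]eq_sym.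
Qed.

Lemma dotv_signed_perm g x y :
  dotv (x *m signed_perm_mx R g) (y *m signed_perm_mx R g) = dotv x y.
Proof.
rewrite !dotvE (reindex_inj (@perm_inj _ g.2)); apply: eq_bigr => i _.
by rewrite !mul_signed_perm mulrACA -expr2 sqrr_sign mul1r.
Qed.

Lemma mulmx_signed_perm_inj g :
  injective (fun x => x *m signed_perm_mx R g).
Proof.
move=> x y xy; apply/rowP => i; have /rowP/(_ (g.2 i)) := xy.
by rewrite !mul_signed_perm; apply/mulfI; rewrite signr_eq0.
Qed.

Definition hyperoct_mul g h : hyperoctahedral d :=
  ([ffun i => g.1 i (+) h.1 (g.2 i)], (g.2 * h.2)%g).

Lemma signed_perm_mxM g h :
  signed_perm_mx R (hyperoct_mul g h) = signed_perm_mx R g *m signed_perm_mx R h.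
Proof.
apply/matrixP => i j; rewrite signed_perm_mxE ffunE permM signr_addb -mulrA.
rewrite -signed_perm_mxE [RHS]mxE (bigD1 (g.2 i)) //=.
rewrite (signed_perm_mxE g) eqxx mulr1 big1 ?addr0 // => k ki.
by rewrite (signed_perm_mxE g) eq_sym (negbTE ki) mulr0 mul0r.
Qed.

Lemma hyperoct_actM g h (W : {vspace 'rV[R]_d}) :
  hyperoct_act h (hyperoct_act g W) = hyperoct_act (hyperoct_mul g h) W.
Proof.
rewrite /hyperoct_act -limg_comp; congr (_ @: _)%VS; apply/lfunP => x.
by rewrite comp_lfunE !lfunE /= signed_perm_mxM; apply/esym/mulmxA.
Qed.

Lemma lker0_signed_perm g :
  lker (linfun (mulmxr (signed_perm_mx R g)) : 'End('rV[R]_d)) == 0%VS.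
Proof.
by apply/lker0P => x y; rewrite !lfunE; apply: mulmx_signed_perm_inj.
Qed.

Lemma hyperoct_act_inj g : injective (@hyperoct_act R d g).
Proof.
by move=> W1 W2 /eqP; rewrite eq_limg_ker0 ?lker0_signed_perm // => /eqP.
Qed.

Lemma dim_hyperoct_act g (W : {vspace 'rV[R]_d}) :
  \dim (hyperoct_act g W) = \dim W.
Proof.
by rewrite limg_dim_eq // (eqP (lker0_signed_perm g)) capv0.
Qed.

End SignedPermutations.

(** * The matrix of an orthogonal projection *)

Section ProjectionMatrix.
Variables (R : realType) (d : nat).
Implicit Types (x y u v : 'rV[R]_d) (W : {vspace 'rV[R]_d}).

Lemma orthoproj_unique W x y :
  y \in W -> (forall w, w \in W -> dotv (x - y) w = 0) -> orthoproj W x = y.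
Proof.
move=> yW xy; apply/eqP; rewrite -subr_eq0; apply/negPn/negP => /dotv_gt0.
have zW : orthoproj W x - y \in W by rewrite rpredB ?mem_orthoproj.
have {1}-> : orthoproj W x - y = (x - y) - (x - orthoproj W x).
  by rewrite [RHS]addrC opprB addrA subrK.
by rewrite linearBl /= xy // orthoproj_ortho // subrr ltxx.
Qed.

Definition projmx W : 'M[R]_d := lin1_mx (orthoproj W).

Lemma orthoprojE W x : orthoproj W x = x *m projmx W.
Proof. by rewrite mul_rV_lin1. Qed.

Lemma dotv_orthoproj W x y :
  dotv (orthoproj W x) (orthoproj W y) = dotv x (orthoproj W y).
Proof.
have /eqP := orthoproj_ortho x (mem_orthoproj W y).
by rewrite linearBl subr_eq0 => /eqP.
Qed.

Lemma dotv_orthoprojE W x :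
  dotv (orthoproj W x) (orthoproj W x) =
  \sum_i \sum_j projmx W i j * (x 0 i * x 0 j).
Proof.
rewrite dotv_orthoproj orthoprojE dotvE exchange_big; apply: eq_bigr => j _.
rewrite [(_ *m _) _ _]mxE mulr_sumr.
by apply: eq_bigr => i _; ring.
Qed.

Lemma dotv_delta x i : dotv (delta_mx 0 i) x = x 0 i.
Proof. by rewrite /dotv -rowE !mxE. Qed.

Lemma projmx_sym W i j : projmx W i j = projmx W j i.
Proof.
rewrite !mxE -(dotv_delta _ j) -(dotv_delta _ i).
by rewrite -[LHS]dotv_orthoproj -[RHS]dotv_orthoproj dotvC.
Qed.

(** The diagonal of [P *m P^T = P], which holds because [P] is symmetric and
    idempotent. *)
Lemma sum_projmx_sqr W i : \sum_j projmx W i j ^+ 2 = projmx W i i.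
Proof.
have := dotv_orthoproj W (delta_mx 0 i) (delta_mx 0 i).
rewrite dotv_delta dotvE mxE => <-.
by apply: eq_bigr => j _; rewrite mxE expr2.
Qed.

Lemma orthoproj_hyperoct g W x :
  orthoproj (hyperoct_act g W) (x *m signed_perm_mx R g) =
  orthoproj W x *m signed_perm_mx R g.
Proof.
have gE y : y *m signed_perm_mx R g =
    (linfun (mulmxr (signed_perm_mx R g)) : 'End('rV[R]_d)) y by rewrite lfunE.
apply: orthoproj_unique => [|w]; first by rewrite gE memv_img // mem_orthoproj.
case/memv_imgP => y yW ->; rewrite -gE -mulmxBl dotv_signed_perm.
exact: orthoproj_ortho.
Qed.

(** The matrix of the projection onto [g W] is [S^T P S], where [S] is the
    signed permutation matrix of [g]. *)
Lemma projmx_hyperoct g W i j :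
  projmx (hyperoct_act g W) (g.2 i) (g.2 j) =
  (-1) ^+ (g.1 i (+) g.1 j) * projmx W i j.
Proof.
have /rowP/(_ (g.2 j)) := orthoproj_hyperoct g W (delta_mx 0 i).
rewrite delta_signed_perm mul_signed_perm linearZ /= !mxE.
move=> /(congr1 ( *%R ((-1) ^+ g.1 i))).
by rewrite !mulrA -expr2 sqrr_sign mul1r -signr_addb.
Qed.

Lemma projmx_orthonormal u v i j :
  dotv u u = 1 -> dotv v v = 1 -> dotv u v = 0 ->
  projmx <<[:: u; v]>> i j = u 0 i * u 0 j + v 0 i * v 0 j.
Proof.
move=> uu vv uv.
have vu : dotv v u = 0 by rewrite dotvC.
rewrite !mxE (@orthoproj_unique _ _ (u 0 i *: u + v 0 i *: v)) ?mxE //.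
  by rewrite rpredD ?rpredZ // memv_span ?inE ?eqxx ?orbT.
rewrite span_cons span_seq1 => w /memv_addP[_ /vlineP[k ->] [_ /vlineP[l ->] ->]].
rewrite linearBl linearDl !linearZl_LR !linearDr !linearZr_LR /=.
by rewrite !dotv_delta uu vv uv vu; ring.
Qed.

Lemma dim_orthonormal u v :
  dotv u u = 1 -> dotv v v = 1 -> dotv u v = 0 -> \dim <<[:: u; v]>>%VS = 2.
Proof.
move=> uu vv uv; suff /eqnP -> : free [:: u; v] by [].
rewrite free_cons span_seq1 free_cons span_nil nil_free andbT memv0.
apply/andP; split.
  apply/negP => /vlineP[k uE]; move: uu; rewrite {1}uE linearZl_LR /=.
  have -> : dotv v u = 0 by rewrite dotvC.
  by rewrite mulr0 => /esym/eqP; rewrite oner_eq0.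
apply/eqP => v0; move: vv; rewrite v0 linear0l.
by move=> /esym/eqP; rewrite oner_eq0.
Qed.

End ProjectionMatrix.

(** * Fourth-order tensors invariant under the hyperoctahedral group *)

(** Two-transitivity of the symmetric group is what makes the entries
    [T i i j j] with [i != j] all equal, and likewise for the other pairings. *)
Lemma perm_2transitive (T : finType) (p q i j : T) :
  p != q -> i != j -> exists s : {perm T}, s p = i /\ s q = j.
Proof.
move=> pq ij; exists (tperm p i * tperm (tperm p i q) j)%g.
rewrite !permM tpermL tpermL; split=> //; rewrite tpermD //; last by rewrite eq_sym.
by rewrite -[X in _ != X](tpermL p i) (inj_eq perm_inj) eq_sym.
Qed.

Lemma sum_delta (R : pzRingType) (I : finType) (i : I) (f : I -> R) :
  \sum_j (i == j)%:R * f j = f i.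
Proof.
rewrite (bigD1 i) //= eqxx mul1r big1 ?addr0 // => j.
by rewrite eq_sym => /negbTE ->; rewrite mul0r.
Qed.

Section InvariantTensors.
Variables (R : realFieldType) (d : nat).
Variable T : 'I_d -> 'I_d -> 'I_d -> 'I_d -> R.

Definition hyperoct_invariant :=
  forall (g : hyperoctahedral d) i j k l,
    T (g.2 i) (g.2 j) (g.2 k) (g.2 l) =
    (-1) ^+ (g.1 i (+) g.1 j (+) g.1 k (+) g.1 l) * T i j k l.

Hypothesis T_inv : hyperoct_invariant.

(** Changing the sign of the coordinate [h] alone turns [T i j k l] into its
    opposite. *)
Lemma tensor_odd h i j k l :
  (i == h) (+) (j == h) (+) (k == h) (+) (l == h) -> T i j k l = 0.
Proof.
move=> odd_h; have /= := T_inv ([ffun i => i == h], 1%g) i j k l.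
rewrite !ffunE !perm1 odd_h expr1 mulN1r => TN.
by lra.
Qed.

Lemma tensor_perm (s : {perm 'I_d}) i j k l :
  T (s i) (s j) (s k) (s l) = T i j k l.
Proof.
by have /= -> := T_inv ([ffun=> false], s) i j k l; rewrite !ffunE mul1r.
Qed.

(** An entry vanishes unless its indices coincide in pairs ([tensor_odd]);
    the three ways of pairing them give the constants [b1], [b2] and [b3], and
    [c] corrects the fully diagonal entries, where all pairings overlap. *)
Lemma invariant_tensorE : (1 < d)%N -> exists b1 b2 b3 c : R,
  forall i j k l, T i j k l =
    (i == j)%:R * (k == l)%:R * b1 + (i == k)%:R * (j == l)%:R * b2
    + (i == l)%:R * (j == k)%:R * b3
    + (i == j)%:R * (i == k)%:R * (i == l)%:R * c.
Proof.
move=> d1; pose p := Ordinal (ltnW d1); pose q := Ordinal d1.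
have pq : p != q by [].
pose b1 := T p p q q; pose b2 := T p q p q; pose b3 := T p q q p.
have Tdiag i : T i i i i = T p p p p.
  by have := tensor_perm (tperm p i) p p p p; rewrite tpermL.
have Toff i j : i != j ->
    [/\ T i i j j = b1, T i j i j = b2 & T i j j i = b3].
  move=> ij; have [s [<- <-]] := perm_2transitive pq ij.
  by rewrite !tensor_perm.
exists b1, b2, b3, (T p p p p - b1 - b2 - b3) => i j k l.
have [<-|ij] := eqVneq i j.
  have [<-|ik] := eqVneq i k.
    have [<-|il] := eqVneq i l; first by rewrite Tdiag /=; ring.
    by rewrite (@tensor_odd l) ?eqxx ?(negbTE il) //=; ring.
  have [<-|kl] := eqVneq k l.
    by have [-> _ _] := Toff _ _ ik; rewrite /=; ring.
  by rewrite (@tensor_odd k) ?eqxx ?(negbTE ik) ?[l == k]eq_sym ?(negbTE kl) //=; ring.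
have [<-|ik] := eqVneq i k.
  have [<-|jl] := eqVneq j l.
    by have [_ -> _] := Toff _ _ ij; rewrite ?[j == i]eq_sym ?(negbTE ij) /=; ring.
  rewrite (@tensor_odd j) ?eqxx ?(negbTE ij) ?[l == j]eq_sym ?(negbTE jl) //=.
  by rewrite ?[j == i]eq_sym ?(negbTE ij) /=; ring.
have [<-|il] := eqVneq i l.
  have [<-|jk] := eqVneq j k.
    by have [_ _ ->] := Toff _ _ ij; rewrite ?[j == i]eq_sym ?(negbTE ij) /=; ring.
  by rewrite (@tensor_odd j) ?eqxx ?(negbTE ij) ?[k == j]eq_sym ?(negbTE jk) //=; ring.
rewrite (@tensor_odd i) ?eqxx ?[_ == i]eq_sym ?(negbTE ij) ?(negbTE ik) ?(negbTE il) //=.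
by ring.
Qed.

(** With [b = b1 + b2 + b3] in the notation of [invariant_tensorE], the left
    side of the relation is [d (d + 2) b + 3 d c] and its right side is
    [d (d + 2) (b + c)], so the relation says that [d (d - 1) c = 0]. *)
Lemma quartic_isotropic : (1 < d)%N ->
  \sum_i \sum_j (T i i j j + T i j i j + T i j j i) =
    (d%:R + 2) * \sum_i T i i i i ->
  exists2 A : R, d%:R * A = \sum_i T i i i i &
    forall x : 'I_d -> R,
      \sum_i \sum_j \sum_k \sum_l T i j k l * (x i * x j * x k * x l) =
      A * (\sum_i x i ^+ 2) ^+ 2.
Proof.
move=> d1; have [b1 [b2 [b3 [c TE]]]] := invariant_tensorE d1.
have sumc (e : R) : \sum_(i < d) e = d%:R * e.
  by rewrite sumr_const card_ord mulr_natl.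
have -> : \sum_i T i i i i = d%:R * (b1 + b2 + b3 + c).
  by rewrite -sumc; apply: eq_bigr => i _; rewrite TE !eqxx /=; ring.
have -> : \sum_i \sum_j (T i i j j + T i j i j + T i j j i) =
    d%:R * (d%:R * (b1 + b2 + b3) + (2 * (b1 + b2 + b3) + 3 * c)).
  rewrite -sumc; apply: eq_bigr => i _; rewrite -sumc.
  rewrite -(sum_delta i (fun=> 2 * (b1 + b2 + b3) + 3 * c)) -big_split /=.
  apply: eq_bigr => j _; rewrite !TE !eqxx [j == i]eq_sym.
  by case: (i == j) => /=; ring.
move=> contr; have c0 : c = 0.
  have : d%:R * (d%:R - 1) * c = 0 :> R by lra.
  move/eqP; rewrite !mulf_eq0 subr_eq0 pnatr_eq0 (eqr_nat R d 1).
  by case/orP => [/orP[]|] /eqP // dE; move: d1; rewrite dE.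
exists (b1 + b2 + b3); first by rewrite c0 addr0.
move=> x; set S := \sum_i x i ^+ 2.
rewrite expr2 mulrA mulr_sumr; apply: eq_bigr => i _.
have sumj (j : 'I_d) : \sum_k \sum_l T i j k l * (x i * x j * x k * x l) =
    (i == j)%:R * (b1 * S * x i ^+ 2) + (b2 + b3) * x i ^+ 2 * x j ^+ 2.
  have suml (k : 'I_d) : \sum_l T i j k l * (x i * x j * x k * x l) =
      (i == j)%:R * (b1 * x i ^+ 2) * x k ^+ 2
      + (i == k)%:R * (b2 * x i * x j ^+ 2 * x k)
      + (j == k)%:R * (b3 * x i ^+ 2 * x j * x k).
    transitivity (\sum_l
        ((k == l)%:R * ((i == j)%:R * b1 * (x i * x j * x k * x l))
        + (j == l)%:R * ((i == k)%:R * b2 * (x i * x j * x k * x l))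
        + (i == l)%:R * ((j == k)%:R * b3 * (x i * x j * x k * x l)))).
      by apply: eq_bigr => l _; rewrite TE c0; ring.
    rewrite !big_split /= !sum_delta.
    by have [->|_] := eqVneq i j; rewrite /=; ring.
  under eq_bigr do rewrite suml.
  by rewrite !big_split /= !sum_delta -mulr_sumr -/S; ring.
under eq_bigr do rewrite sumj.
by rewrite big_split /= sum_delta -mulr_sumr -/S; ring.
Qed.

End InvariantTensors.

(** * Tightness of stable families of planes *)

Section InvariantFamilies.
Variables (R : realType) (d : nat).
Variable X : {fset {vspace 'rV[R]_d}}.

Definition hyperoct_stable :=
  forall (g : hyperoctahedral d) W, W \in X -> hyperoct_act g W \in X.

Hypothesis X_stable : hyperoct_stable.

(** The action of [g] is injective, hence permutes the finite family [X]. *)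
Lemma sum_hyperoct_stable (f : {vspace 'rV[R]_d} -> R) (g : hyperoctahedral d) :
  \sum_(W <- X) f (hyperoct_act g W) = \sum_(W <- X) f W.
Proof.
rewrite -(big_map (hyperoct_act g) xpredT f); apply: perm_big.
have gX_uniq : uniq [seq hyperoct_act g W | W <- X].
  by rewrite (map_inj_uniq (@hyperoct_act_inj R d g)) fset_uniq.
have gX_sub : {subset [seq hyperoct_act g W | W <- X] <= X}.
  by move=> _ /mapP[W WX ->]; apply: X_stable.
apply: uniq_perm => //; first exact: fset_uniq.
have X_le : (size X <= size [seq hyperoct_act g W | W <- X])%N by rewrite size_map.
by have [_] := uniq_min_size gX_uniq gX_sub X_le.
Qed.

Definition moment_tensor (i j k l : 'I_d) : R :=
  \sum_(W <- X) projmx W i j * projmx W k l.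

Lemma moment_tensor_invariant : hyperoct_invariant moment_tensor.
Proof.
move=> g i j k l; rewrite /moment_tensor mulr_sumr.
rewrite -(sum_hyperoct_stable _ g); apply: eq_bigr => W _.
by rewrite (projmx_hyperoct g W i j) (projmx_hyperoct g W k l) mulrACA
  -signr_addb addbA.
Qed.

Lemma sum_norm2_orthoproj x :
  \sum_(W <- X) norm2 (orthoproj W x) ^+ 4 =
  \sum_i \sum_j \sum_k \sum_l
    moment_tensor i j k l * (x 0 i * x 0 j * x 0 k * x 0 l).
Proof.
transitivity (\sum_(W <- X) \sum_i \sum_j \sum_k \sum_l
    projmx W i j * projmx W k l * (x 0 i * x 0 j * x 0 k * x 0 l)).
  apply: eq_bigr => W _; rewrite (exprM _ 2 2) /norm2 sqr_sqrtr ?dotv_ge0 //.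
  rewrite dotv_orthoprojE expr2 mulr_suml; apply: eq_bigr => i _.
  rewrite mulr_suml; apply: eq_bigr => j _.
  rewrite mulr_sumr; apply: eq_bigr => k _.
  by rewrite mulr_sumr; apply: eq_bigr => l _; ring.
do 4![rewrite exchange_big; apply: eq_bigr => ? _].
by rewrite mulr_suml.
Qed.

(** Each plane contributes [(tr P)^2 + 2 sum_ij P_ij^2 = 4 + 2 tr P = 8] to the
    contractions of the moment tensor, and the hypothesis on the diagonal
    entries says that it also contributes 8 to [d + 2] times the diagonal
    sum. *)
Lemma invariant_TFF2 : (1 < d)%N -> X != fset0 ->
  {subset X <= Gr 2} ->
  {in X, forall W, \sum_i projmx W i i = 2} ->
  {in X, forall W, (d%:R + 2) * \sum_i projmx W i i ^+ 2 = 8} ->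
  equal_weight_TFF2 X.
Proof.
move=> d1 X0 XG tr2 diag8; split=> //.
have dT : (d%:R + 2) * \sum_i moment_tensor i i i i = \sum_(W <- X) 8.
  rewrite exchange_big mulr_sumr; apply: eq_big_seq => W WX /=.
  by rewrite -(diag8 W WX).
have contr : \sum_i \sum_j (moment_tensor i i j j + moment_tensor i j i j
    + moment_tensor i j j i) = (d%:R + 2) * \sum_i moment_tensor i i i i.
  transitivity (\sum_(W <- X) \sum_i \sum_j (projmx W i i * projmx W j j
      + projmx W i j * projmx W i j + projmx W i j * projmx W j i)).
    do 2![rewrite [RHS]exchange_big; apply: eq_bigr => ? _].
    by rewrite !big_split.
  rewrite dT; apply: eq_big_seq => W WX /=.
  transitivity (\sum_i (projmx W i i * 2 + 2 * projmx W i i)).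
    apply: eq_bigr => i _; transitivity (projmx W i i * (\sum_j projmx W j j)
        + 2 * \sum_j projmx W i j ^+ 2); last by rewrite tr2 // sum_projmx_sqr.
    rewrite !mulr_sumr -big_split; apply: eq_bigr => j _.
    by rewrite (projmx_sym W j i) /=; ring.
  by rewrite big_split /= -mulr_suml -mulr_sumr tr2 //; ring.
(* The same computation gives (d + 2) d A = 8 #|X|, hence A > 0. *)
have [A dA quartic] := quartic_isotropic moment_tensor_invariant d1 contr.
exists A => [|x].
  have : (d%:R + 2) * (d%:R * A) = \sum_(W <- X) 8 :> R by rewrite dA.
  rewrite big_const_seq count_predT iter_addr_0 => dA8.
  have d_gt0 : 0 < d%:R :> R by rewrite ltr0n ltnW.
  have : 0 < (d%:R + 2) * (d%:R * A).
    by rewrite dA8 pmulrn_lgt0 ?cardfs_gt0.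
  by rewrite !pmulr_rgt0 // addr_gt0.
rewrite sum_norm2_orthoproj quartic (exprM _ 2 2) sqr_sqrtr ?dotv_ge0 //.
by rewrite dotvE.
Qed.

End InvariantFamilies.

(** * Orbits of planes *)

Section OrbitOfPlane.
Variables (R : realType) (d : nat).

(** Both diagonal conditions of [invariant_TFF2] only have to be checked on one
    plane of the orbit, because a signed permutation merely permutes the
    diagonal entries of the projection matrix: its signs cancel there. *)
Lemma orbit_TFF2 (u v : 'rV[R]_d) : (1 < d)%N ->
  dotv u u = 1 -> dotv v v = 1 -> dotv u v = 0 ->
  (d%:R + 2) * \sum_i (u 0 i ^+ 2 + v 0 i ^+ 2) ^+ 2 = 8 ->
  equal_weight_TFF2
    [fset hyperoct_act g <<[:: u; v]>>%VS | g in {: hyperoctahedral d}]%fset.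
Proof.
move=> d1 uu vv uv diag8.
have PE i : projmx <<[:: u; v]>> i i = u 0 i ^+ 2 + v 0 i ^+ 2.
  by rewrite projmx_orthonormal.
have diag_act (f : R -> R) g : \sum_i f (projmx (hyperoct_act g <<[:: u; v]>>) i i) =
    \sum_i f (u 0 i ^+ 2 + v 0 i ^+ 2).
  rewrite (reindex_inj (@perm_inj _ g.2)); apply: eq_bigr => i _.
  by rewrite projmx_hyperoct addbb mul1r PE.
apply: invariant_TFF2 => //.
- move=> g _ /imfsetP[h _ ->]; rewrite hyperoct_actM.
  by apply/imfsetP; exists (hyperoct_mul h g).
- apply/fset0Pn; exists (hyperoct_act ([ffun=> false], 1%g) <<[:: u; v]>>%VS).
  by apply/imfsetP; exists ([ffun=> false], 1%g).
- move=> _ /imfsetP[g _ ->].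
  by rewrite inE dim_hyperoct_act dim_orthonormal.
- move=> _ /imfsetP[g _ ->]; rewrite (diag_act id) big_split /=.
  by move: uu vv; rewrite !dotvE => <- <-; congr (_ + _); apply: eq_bigr.
- by move=> _ /imfsetP[g _ ->]; rewrite (diag_act (fun t => t ^+ 2)).
Qed.

Lemma sum_indicator m n : (n <= d)%N ->
  \sum_(i < d) (m <= i < n)%:R = (n - m)%:R :> R.
Proof.
move=> nd; rewrite -natr_sum; congr (_ %:R).
rewrite -[RHS]muln1 -sum_nat_const_nat (big_nat_widen m n d xpredT _ nd).
rewrite (big_nat_widenl m 0) // big_mkord [RHS]big_mkcond.
by apply: eq_bigr => i _ /=; rewrite andbC; case: (_ && _).
Qed.

Lemma sum_delta_mx (P : pred 'I_d) i :
  (\sum_(k | P k) delta_mx 0 k : 'rV[R]_d) 0 i = (P i)%:R.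
Proof.
rewrite summxE big_mkcond (bigD1 i) //= mxE !eqxx big1 ?addr0 => [|k ki].
  by case: (P i).
by rewrite mxE eq_sym (negbTE ki) andbF if_same.
Qed.

Lemma u0E a i : u0 R d a 0 i = (Num.sqrt a%:R)^-1 * (0 <= i < a)%:R.
Proof. by rewrite mxE sum_delta_mx. Qed.

Lemma v0E a b i : v0 R d a b 0 i = (Num.sqrt b%:R)^-1 * (a <= i < a + b)%:R.
Proof. by rewrite mxE sum_delta_mx. Qed.

End OrbitOfPlane.

(** The supports of [u0] and [v0] are disjoint, so the projection matrix has
    [a] diagonal entries [1 / a], [b] diagonal entries [1 / b] and zeros
    elsewhere; the sum of their squares is [1 / a + 1 / b]. *)
Lemma orbit_ab_TFF2 (R : realType) (d a b : nat) :
  (0 < a)%N -> (0 < b)%N -> (a + b <= d)%N ->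
  ((d + 2) * (a + b) = 8 * a * b)%N ->
  equal_weight_TFF2 (orbit_ab R d a b).
Proof.
move=> a0 b0 abd dab.
have sqr_inv_sqrt (n : nat) : (Num.sqrt n%:R)^-1 ^+ 2 = n%:R^-1 :> R.
  by rewrite exprVn sqr_sqrtr.
have nz (n : nat) : (0 < n)%N -> n%:R != 0 :> R by rewrite pnatr_eq0 -lt0n.
have u2 i : u0 R d a 0 i ^+ 2 = a%:R^-1 * (0 <= i < a)%:R.
  by rewrite u0E exprMn sqr_inv_sqrt; case: (_ && _) => /=; ring.
have v2 i : v0 R d a b 0 i ^+ 2 = b%:R^-1 * (a <= i < a + b)%:R.
  by rewrite v0E exprMn sqr_inv_sqrt; case: (_ && _) => /=; ring.
have disj (i : nat) : (0 <= i < a)%:R * (a <= i < a + b)%:R = 0 :> R.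
  by case: leqP => /=; rewrite ?(mulr0, mul0r).
have ad : (a <= d)%N by apply: leq_trans abd; apply: leq_addr.
apply: orbit_TFF2.
- by apply: leq_trans abd; rewrite -(addn1 1) leq_add.
- rewrite dotvE; under eq_bigr do rewrite -expr2 u2.
  by rewrite -mulr_sumr sum_indicator // subn0 mulVf ?nz.
- rewrite dotvE; under eq_bigr do rewrite -expr2 v2.
  by rewrite -mulr_sumr sum_indicator // addKn mulVf ?nz.
- by rewrite dotvE big1 // => i _; rewrite u0E v0E mulrACA disj mulr0.
- have diagE i : (u0 R d a 0 i ^+ 2 + v0 R d a b 0 i ^+ 2) ^+ 2 =
      a%:R^-1 ^+ 2 * (0 <= i < a)%:R + b%:R^-1 ^+ 2 * (a <= i < a + b)%:R.
    by rewrite u2 v2; case: ltnP => _ /=; [|case: (i < a + b)%N => /=]; ring.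
  under eq_bigr do rewrite diagE.
  rewrite big_split /= -!mulr_sumr (sum_indicator _ 0 ad) (sum_indicator _ a abd).
  rewrite subn0 addKn.
  have dabR : (d%:R + 2) * (a%:R + b%:R) = 8 * a%:R * b%:R :> R.
    by rewrite -!natrD -!natrM dab.
  transitivity ((d%:R + 2) * (a%:R + b%:R) / (a%:R * b%:R) : R).
    by field; rewrite !nz.
  by rewrite dabR; field; rewrite !nz.
Qed.

Theorem theorem4p9 (R : realType) (d0 a0 b0 : nat)
    (hparam : ((d0 + 2) * (a0 + b0) = 8 * a0 * b0)%N)
    (ha0 : (1 <= a0 <= b0)%N) (hd0 : (a0 + b0 <= d0)%N)
    (s : nat) (hs : (1 <= s)%N) :
  let d := ((d0 + 2) * s - 2)%N in
  let a := (a0 * s)%N in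
  let b := (b0 * s)%N in
  equal_weight_TFF2 (orbit_ab R d a b).
Proof.
move=> d a b; have [d_ge2 abd] := params_admissible hd0 hs.
have /andP[a0_gt0 ab0] := ha0.
apply: orbit_ab_TFF2 => //.
- by rewrite muln_gt0 a0_gt0.
- by rewrite muln_gt0 (leq_trans a0_gt0 ab0).
(* Since d + 2 = (d0 + 2) s, the equation is hparam multiplied by s ^ 2. *)
- rewrite /d subnK // -mulnDl mulnACA hparam.
  by rewrite /a /b -!mulnA (mulnCA s).
Qed.
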